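(* Let $k,d$ be integers with $0<k<d$. Then there is $\varepsilon=\varepsilon(k,d)>0$ such that every $\varepsilon$-net $\mathcal{G}_\varepsilon\subset \mathrm{Gr}(k,d)$ has the following property: there is no polyhedral cone $C\subset\mathbb{R}^d$ such that $U\cap C$ is a $k$-dimensional face of $C$ for every $U\in\mathcal{G}_\varepsilon$.
   Context: $\mathrm{Gr}(k,d)$ is the Grassmannian of $k$-dimensional linear subspaces of $\mathbb{R}^d$. Let $B$ be the Euclidean unit ball centered at the origin. For $U,V\in\mathrm{Gr}(k,d)$, $d(U,V)$ is the Hausdorff distance between $U\cap B$ and $V\cap B$, and the angle between them is $\angle(U,V)=\arcsin(d(U,V))$. An $\varepsilon$-net is a set $\mathcal{G}_\varepsilon\subset\mathrm{Gr}(k,d)$ such that for every $U\in\mathrm{Gr}(k,d)$ there is $V\in\mathcal{G}_\varepsilon$ with $\angle(U,V)<\varepsilon$. A polyhedral cone is an intersection of finitely many closed linear halfspaces. *)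

(* Defs.v *)
From HB Require Import structures.
From mathcomp Require Import all_boot all_order all_algebra.
From mathcomp Require Import all_classical all_reals.
From mathcomp Require Import trigo.
From mathcomp Require Import Rstruct.
Set Implicit Arguments. Unset Strict Implicit. Unset Printing Implicit Defensive.
Import Order.TTheory GRing.Theory Num.Theory.
Local Open Scope classical_set_scope.
Local Open Scope ring_scope.

Section Grassmann.
Variables (R : realType) (d : nat).
Notation vec := 'rV[R]_d.

Definition dotv (x y : vec) : R := (x *m y^T) 0 0.
Definition enorm (x : vec) : R := Num.sqrt (dotv x x).

Definition unit_ball : set vec := [set x | enorm x <= 1].

Definition subsp (U : 'M[R]_d) : set vec := [set x | (x <= U)%MS].

(* Gr(k,d): linear subspaces of dimension k, represented by matrices
   whose row space is the subspace *)
Definition Gr (k : nat) : set 'M[R]_d := [set U | \rank U = k].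

Definition dist_to (x : vec) (B : set vec) : R := inf [set enorm (x - b) | b in B].
Definition hausdorff (A B : set vec) : R :=
  Num.max (sup [set dist_to a B | a in A]) (sup [set dist_to b A | b in B]).

Definition grdist (U V : 'M[R]_d) : R :=
  hausdorff (subsp U `&` unit_ball) (subsp V `&` unit_ball).
Definition grangle (U V : 'M[R]_d) : R := asin (grdist U V).

Definition is_eps_net (k : nat) (eps : R) (G : set 'M[R]_d) : Prop :=
  G `<=` Gr k /\ forall U, Gr k U -> exists2 V, G V & grangle U V < eps.

Definition polyhedral_cone (C : set vec) : Prop :=
  exists (m : nat) (a : 'I_m -> vec), C = [set x | forall i, dotv (a i) x <= 0].

(* face of a (convex polyhedral) cone: intersection with a supporting
   hyperplane through the origin (c = 0 gives C itself) *)
Definition is_face (C F : set vec) : Prop :=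
  exists c : vec, (forall x, C x -> dotv c x <= 0) /\
                  F = C `&` [set x | dotv c x = 0].

(* the (linear = affine, as S contains 0 here) dimension of S is k:
   S contains k linearly independent vectors and lies in their span *)
Definition set_dim (S : set vec) (k : nat) : Prop :=
  exists M : 'M[R]_(k, d),
    [/\ forall i, S (row i M), row_free M & forall x, S x -> (x <= M)%MS].

End Grassmann.

(* Main.v *)
(* If [U ∩ C] is a [k]-dimensional face of [C], then [C] contains a unit vector of
   [U] and its polar cone [D] contains a unit vector of the orthogonal complement
   of [U].  If the theorem failed, an ultrafilter limit of counterexamples with
   [eps -> 0] would give sets [C], [D] with [dotv x y <= 0] on [C × D] such that
   [C] meets every [k]-dimensional [U], and [D] every orthogonal complement of
   such a [U], in a nonzero vector.  This is impossible: take orthogonal subspaces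
   [A], [P] of maximal total dimension with [dim A < k], [dim P < d - k] that meet
   [C], resp. [D], only in 0.  By maximality, for each nonzero [n] orthogonal to
   [A + P], a nonzero multiple [s n] lies in [C + A] and a nonzero multiple [t n]
   lies in [D + P], and [s t < 0].  Such [n] form a space of dimension at least 2;
   comparing orthogonal [e], [f] with [e - f] is contradictory. *)
Require Import Defs.
From HB Require Import structures.
From mathcomp Require Import all_boot all_order all_algebra.
From mathcomp Require Import all_classical all_reals.
From mathcomp Require Import topology normedtype sequences trigo.
From mathcomp Require Import lra zify.
From mathcomp Require Import Rstruct.
Import Order.TTheory GRing.Theory Num.Theory.
Import numFieldNormedType.Exports.
Local Open Scope classical_set_scope.
Local Open Scope ring_scope.

(** * The dot product and orthogonality *)

Section DotProduct.
Context {R : realType} {d : nat}.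
Implicit Types (x y z u v : 'rV[R]_d) (c : R).

Lemma dotvE x y : dotv x y = \sum_j x 0 j * y 0 j.
Proof. by rewrite /dotv mxE; apply: eq_bigr => j _; rewrite mxE. Qed.

Lemma dotvC x y : dotv x y = dotv y x.
Proof. by rewrite !dotvE; apply: eq_bigr => j _; rewrite mulrC. Qed.

Lemma dotvDl x y z : dotv (x + y) z = dotv x z + dotv y z.
Proof. by rewrite /dotv mulmxDl mxE. Qed.

Lemma dotvZl c x z : dotv (c *: x) z = c * dotv x z.
Proof. by rewrite /dotv -scalemxAl mxE. Qed.

Lemma dotvDr x y z : dotv z (x + y) = dotv z x + dotv z y.
Proof. by rewrite dotvC dotvDl !(dotvC z). Qed.

Lemma dotvZr c x z : dotv z (c *: x) = c * dotv z x.
Proof. by rewrite dotvC dotvZl (dotvC z). Qed.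

Lemma dotvNl x z : dotv (- x) z = - dotv x z.
Proof. by rewrite -scaleN1r dotvZl mulN1r. Qed.

Lemma dotvNr x z : dotv z (- x) = - dotv z x.
Proof. by rewrite dotvC dotvNl (dotvC z). Qed.

Definition dotv_bilinear := (dotvDl, dotvDr, dotvNl, dotvNr, dotvZl, dotvZr).

Lemma dotv0l x : dotv 0 x = 0.
Proof. by rewrite /dotv mul0mx mxE. Qed.

Lemma dotv_ge0 x : 0 <= dotv x x.
Proof. by rewrite dotvE sumr_ge0 // => j _; rewrite -expr2 sqr_ge0. Qed.

Lemma dotv_eq0 x : (dotv x x == 0) = (x == 0).
Proof.
apply/eqP/eqP => [|->]; last exact: dotv0l.
rewrite dotvE => /eqP; rewrite psumr_eq0 => [/allP x0|j _]; last first.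
  by rewrite -expr2 sqr_ge0.
apply/rowP => j; rewrite mxE; apply/eqP.
by have := x0 j (mem_index_enum j); rewrite /= mulf_eq0 orbb.
Qed.

Lemma dotv_gt0 x : x != 0 -> 0 < dotv x x.
Proof. by move=> x0; rewrite lt_def dotv_eq0 x0 dotv_ge0. Qed.

Lemma enorm_ge0 x : 0 <= enorm x.
Proof. exact: sqrtr_ge0. Qed.

Lemma enorm_sqr x : enorm x ^+ 2 = dotv x x.
Proof. by rewrite sqr_sqrtr // dotv_ge0. Qed.

Lemma enorm0 : enorm (0 : 'rV[R]_d) = 0.
Proof. by rewrite /enorm dotv0l sqrtr0. Qed.

Lemma enorm_gt0 x : x != 0 -> 0 < enorm x.
Proof. by move=> x0; rewrite sqrtr_gt0 dotv_gt0. Qed.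

Lemma cauchy_schwarz x y : `|dotv x y| <= enorm x * enorm y.
Proof.
have [->|y0] := eqVneq y 0.
  by rewrite dotvC dotv0l normr0 mulr_ge0 ?enorm_ge0.
have yy := dotv_gt0 _ y0.
rewrite -(@ler_pXn2r _ 2) // ?nnegrE ?mulr_ge0 ?enorm_ge0 //.
rewrite real_normK ?num_real // exprMn !enorm_sqr.
(* The vector is [dotv y y] times the component of [x] orthogonal to [y]; its squared norm is
   [c * (a * c - b ^+ 2)]. *)
have := dotv_ge0 (dotv y y *: x - dotv x y *: y).
rewrite !dotv_bilinear (dotvC y x).
set a := dotv x x; set b := dotv x y; set c := dotv y y => h.
have {}h : 0 <= c * (a * c - b ^+ 2) by move: h; rewrite expr2; lra.
by rewrite pmulr_rge0 // subr_ge0 in h.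
Qed.

Lemma orthP m (A : 'M[R]_(m, d)) x :
  x *m A^T = 0 <-> (forall v, (v <= A)%MS -> dotv x v = 0).
Proof.
split=> [xA v /submxP[w ->]|xA].
  by rewrite /dotv trmx_mul mulmxA xA mul0mx mxE.
apply/rowP => i; rewrite [RHS]mxE -(xA (row i A) (row_sub i A)).
by rewrite dotvE mxE; apply: eq_bigr => j _; rewrite !mxE.
Qed.

(** The columns of [cokermx A] are themselves orthogonal to [A], and being killed by all of them
    characterises the row space. *)
Lemma orth_orth_sub m (A : 'M[R]_(m, d)) x :
  (forall z, z *m A^T = 0 -> dotv x z = 0) -> (x <= A)%MS.
Proof.
move=> xA; rewrite submxE; apply/eqP/rowP => j; rewrite [RHS]mxE.
rewrite -(xA (row j (cokermx A)^T)).
  by rewrite dotvE mxE; apply: eq_bigr => i _; rewrite !mxE.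
by rewrite -row_mul -trmx_mul mulmx_coker trmx0; apply/rowP => i; rewrite !mxE.
Qed.

Lemma exists_orth m (A : 'M[R]_(m, d)) :
  (\rank A < d)%N -> exists2 x : 'rV[R]_d, x != 0 & x *m A^T = 0.
Proof.
move=> rA; have : kermx A^T != 0.
  by rewrite -mxrank_eq0 mxrank_ker mxrank_tr subn_eq0 -ltnNge.
by case/rowV0Pn => x /sub_kermxP xA x0; exists x.
Qed.

Lemma mxrank_adds_orth m (A : 'M[R]_(m, d)) x :
  x != 0 -> x *m A^T = 0 -> \rank (A + x)%MS = (\rank A).+1.
Proof.
move=> x0 /orthP xA; rewrite mxrank_disjoint_sum ?rank_rV ?x0 ?addn1 //.
apply/eqP/rowV0P => v; rewrite sub_capmx => /andP[vA /sub_rVP[c vc]].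
have /eqP := xA v vA; rewrite vc dotvZr mulf_eq0 dotv_eq0 (negPf x0) orbF.
by move=> /eqP ->; rewrite scale0r.
Qed.

(** * Two sets with nonpositive mutual dot products *)

Lemma meets_extension (C : set 'rV[R]_d) m (A : 'M[R]_(m, d)) n :
    (forall x, C x -> (x <= A)%MS -> x = 0) ->
    (exists x : 'rV[R]_d, [/\ C x, x != 0 & (x <= A + n)%MS]) ->
  exists (x a : 'rV[R]_d) (s : R), [/\ C x, (a <= A)%MS, s != 0 & x = a + s *: n].
Proof.
move=> CA [x [Cx x0 /sub_addsmxP[[w t] /= xE]]].
have /sub_rVP[s ts] : (t *m n <= n)%MS by exact: submxMl.
exists x, (w *m A), s; split; rewrite ?submxMl -?ts //.
apply: contra x0 => /eqP s0; apply/eqP/CA => //.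
by rewrite xE ts s0 scale0r addr0 submxMl.
Qed.

(* The induction grows the orthogonal pair [A], [P]; when neither can grow,
   every [n] orthogonal to both lies, up to sign, in [C + A] and in [D + P],
   with opposite signs. *)
Lemma no_nonpositive_pair_rec (k l : nat) (C D : set 'rV[R]_d) :
    (k + l)%N = d ->
    (forall x y, C x -> D y -> dotv x y <= 0) ->
    (forall U : 'M_d, \rank U = k -> exists x : 'rV[R]_d, [/\ C x, x != 0 & (x <= U)%MS]) ->
    (forall W : 'M_d, \rank W = l -> exists y : 'rV[R]_d, [/\ D y, y != 0 & (y <= W)%MS]) ->
  forall (m : nat) (A P : 'M[R]_d), (d <= m + (\rank A + \rank P))%N ->
    (\rank A < k)%N -> (\rank P < l)%N ->
    (forall a p, (a <= A)%MS -> (p <= P)%MS -> dotv a p = 0) ->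
    (forall x, C x -> (x <= A)%MS -> x = 0) ->
    (forall y, D y -> (y <= P)%MS -> y = 0) -> False.
Proof.
(* [m] bounds the dimension left outside [A + P]. At [m = 0] the ranks sum to at least [d = k + l],
   against [rA] and [rP]. *)
move=> kld CD meetC meetD; elim=> [|m IHm] A P dm rA rP AP CA DP; first lia.
have orthS (n : 'rV_d) : n *m (A + P)%MS^T = 0 ->
    (forall a, (a <= A)%MS -> dotv n a = 0) /\
    (forall p, (p <= P)%MS -> dotv n p = 0).
  move=> /orthP nAP; split=> v vS; apply: nAP.
    exact: submx_trans vS (addsmxSl _ _).
  exact: submx_trans vS (addsmxSr _ _).
have extC (n : 'rV_d) : n != 0 -> n *m (A + P)%MS^T = 0 ->
    exists (x a : 'rV[R]_d) (s : R), [/\ C x, (a <= A)%MS, s != 0 & x = a + s *: n].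
  move=> n0 /orthS[nA nP]; apply: meets_extension => //.
  have rAn : \rank (A + n)%MS = (\rank A).+1.
    by apply: mxrank_adds_orth => //; apply/orthP.
  (* In dimension [k] the hypothesis on [C] applies; below [k], if [C] missed [A + n], the pair
     [A + n], [P] would be a larger admissible one. *)
  have [/meetC //|/eqP rk] := eqVneq (\rank (A + n)%MS) k.
  apply: contrapT => noC; apply: (IHm (A + n)%MS P) => //; try lia.
  - move=> a p /sub_addsmxP[[w t] /= ->] pP.
    have /sub_rVP[s ->] : (t *m n <= n)%MS by exact: submxMl.
    by rewrite dotvDl dotvZl nP // mulr0 addr0 AP // submxMl.
  - move=> x Cx xAn; apply/eqP; apply: contrapT => /negP x0.
    by apply: noC; exists x.
have extD (n : 'rV_d) : n != 0 -> n *m (A + P)%MS^T = 0 ->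
    exists (y p : 'rV[R]_d) (t : R), [/\ D y, (p <= P)%MS, t != 0 & y = p + t *: n].
  move=> n0 /orthS[nA nP]; apply: meets_extension => //.
  have rPn : \rank (P + n)%MS = (\rank P).+1.
    by apply: mxrank_adds_orth => //; apply/orthP.
  have [/meetD //|/eqP rl] := eqVneq (\rank (P + n)%MS) l.
  apply: contrapT => noD; apply: (IHm A (P + n)%MS) => //; try lia.
  - move=> a p aA /sub_addsmxP[[w t] /= ->].
    have /sub_rVP[s ->] : (t *m n <= n)%MS by exact: submxMl.
    by rewrite dotvDr dotvZr (dotvC a n) nA // mulr0 addr0 AP // submxMl.
  - move=> y Dy yPn; apply/eqP; apply: contrapT => /negP y0.
    by apply: noD; exists y.
(* Pairing [a + s *: e] in [C] with [p + t *: e] in [D] gives [s * t * dotv e e <= 0]. Absorbing [s]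
   into [e] turns the opposite signs into a positive coefficient after a minus sign. *)
have normalized (e : 'rV_d) : e != 0 -> e *m (A + P)%MS^T = 0 ->
    exists (s : R) (y p : 'rV[R]_d) (t : R), [/\ s != 0, 0 < t, D y, (p <= P)%MS &
      y = p - t *: (s *: e)].
  move=> e0 eAP; have [eA eP] := orthS _ eAP.
  have [x [a [s [Cx aA s0 xE]]]] := extC _ e0 eAP.
  have [y [p [t [Dy pP t0 yE]]]] := extD _ e0 eAP.
  have := CD _ _ Cx Dy.
  rewrite xE yE !dotv_bilinear AP // (dotvC a e) eA // eP // => st.
  have {}st : s * t * dotv e e <= 0 by lra.
  rewrite pmulr_lle0 ?dotv_gt0 // in st.
  exists s, y, p, (- (t / s)); split => //; last first.
    by rewrite scalerA mulNr divfK // scaleNr opprK.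
  have s2 : 0 < s ^+ 2 by rewrite lt_def sqr_ge0 expf_neq0.
  rewrite oppr_gt0 -(pmulr_llt0 _ s2) expr2 mulrA divfK // mulrC.
  by rewrite lt_def st eq_sym mulf_neq0.
(* The ranks are at most [k - 1] and [l - 1], so [A + P] has codimension at least 2: room for [e]
   and then for [f] orthogonal to it. *)
have [e e0 eAP] : exists2 e : 'rV_d, e != 0 & e *m (A + P)%MS^T = 0.
  by apply: exists_orth; have := mxrank_adds_leqif A P => -[]; lia.
have [f f0 fAPe] : exists2 f : 'rV_d, f != 0 & f *m (A + P + e)%MS^T = 0.
  apply: exists_orth; rewrite mxrank_adds_orth //.
  by have := mxrank_adds_leqif A P => -[]; lia.
have /orthP fS := fAPe.
have fe : dotv f e = 0 by apply: fS; exact: addsmxSr.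
have fAP : f *m (A + P)%MS^T = 0.
  by apply/orthP => v vAP; apply: fS; exact: submx_trans vAP (addsmxSl _ _).
have [s1 [y1 [p1 [t1 [s10 t10 Dy1 p1P y1E]]]]] := normalized _ e0 eAP.
have [s2 [y2 [p2 [t2 [s20 t20 Dy2 p2P y2E]]]]] := normalized _ f0 fAP.
set e' := s1 *: e in y1E; set f' := s2 *: f in y2E.
have e'0 : 0 < dotv e' e' by rewrite dotv_gt0 // scaler_eq0 negb_or s10.
have f'0 : 0 < dotv f' f' by rewrite dotv_gt0 // scaler_eq0 negb_or s20.
have ef : dotv e' f' = 0 by rewrite !dotv_bilinear dotvC fe !mulr0.
have gAP : (e' - f') *m (A + P)%MS^T = 0.
  by rewrite mulmxBl -!scalemxAl eAP fAP !scaler0 subr0.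
have ea a : (a <= A)%MS -> dotv a e' = 0.
  by move=> aA; have [eA _] := orthS _ eAP; rewrite dotvZr dotvC eA // mulr0.
have fa a : (a <= A)%MS -> dotv a f' = 0.
  by move=> aA; have [fA _] := orthS _ fAP; rewrite dotvZr dotvC fA // mulr0.
clearbody e' f'.
have g0 : e' - f' != 0.
  rewrite -dotv_eq0 !dotv_bilinear (dotvC f' e') ef gt_eqF //; lra.
have [x [a [s [Cx aA s0 xE]]]] := extC _ g0 gAP.
have [_ gP] := orthS _ gAP.
(* With [x = a + s *: (e' - f')], pairing with [y1] gives [- s * t1 * dotv e' e' <= 0], forcing
   [s >= 0], while [y2] gives [s * t2 * dotv f' f' <= 0], forcing [s <= 0]. *)
have := CD _ _ Cx Dy1; have := CD _ _ Cx Dy2.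
rewrite xE y1E y2E !(dotvDl a) !(dotvZl s) !(dotvDr p1) !(dotvDr p2).
rewrite (gP p1) // (gP p2) // (AP a p1) // (AP a p2) // !dotv_bilinear ea // fa // (dotvC f' e') ef.
have [sp|sn|] := ltgtP s 0; last by move/eqP; rewrite (negPf s0).
  have : 0 < - s * t1 * dotv e' e' by rewrite !mulr_gt0 // oppr_gt0.
  lra.
have : 0 < s * t2 * dotv f' f' by rewrite !mulr_gt0.
lra.
Qed.

Lemma no_nonpositive_pair (k : nat) (C D : set 'rV[R]_d) :
    (0 < k)%N -> (k < d)%N ->
    (forall x y, C x -> D y -> dotv x y <= 0) ->
    (forall U : 'M_d, \rank U = k -> exists x : 'rV[R]_d, [/\ C x, x != 0 & (x <= U)%MS]) ->
    (forall U : 'M_d, \rank U = k ->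
       exists y : 'rV[R]_d, [/\ D y, y != 0 & y *m U^T = 0]) -> False.
Proof.
move=> k0 kd CD meetC meetD.
apply: (@no_nonpositive_pair_rec k (d - k) C D _ CD meetC _ d 0 0);
  rewrite ?mxrank0 ?addn0 ?subn_gt0 ?subnKC //; try exact: ltnW.
(* A [W] of dimension [d - k] is the orthogonal complement of [kermx W^T], which has dimension
   [k]. *)
- move=> W rW; have [|y [Dy y0 yW]] := meetD (kermx W^T).
    by rewrite mxrank_ker mxrank_tr rW subKn // ltnW.
  exists y; split => //; apply: orth_orth_sub => z /sub_kermxP zW.
  by move/orthP: yW; apply.
- by move=> a p; rewrite submx0 => /eqP -> _; exact: dotv0l.
- by move=> x _; rewrite submx0 => /eqP.
- by move=> x _; rewrite submx0 => /eqP.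
Qed.

End DotProduct.

(** * Passing to the limit along an ultrafilter *)

(** If [B] lies in a proper filter finer than the image, the preimage of its complement cannot be in
    [F], so the preimage of [B] is. *)
Lemma ultra_fmap (T U : Type) (f : T -> U) (F : set_system T) :
  UltraFilter F -> UltraFilter (f @ F).
Proof.
move=> FU; have FP : ProperFilter F by exact: ultra_proper.
split; first exact: fmap_proper_filter.
move=> G GP FG; apply/seteqP; split => // B GB.
have [//|FnB] := in_ultra_setVsetC (f @^-1` B) FU.
have GnB : G (~` B) by exact: FG.
by have /filter_not_empty : G set0 by rewrite -(setICr B); exact: filterI.
Qed.

Lemma ultra_bounded_cvg (R : realType) (T : Type) (F : set_system T)
    (u : T -> R) (M : R) :
  UltraFilter F -> (forall t, `|u t| <= M) -> exists l : R, u @ F --> l.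
Proof.
move=> FU uM; have FP : ProperFilter F by exact: ultra_proper.
have := @segment_compact R (- M) M; rewrite compact_ultra.
move=> /(_ (u @ F) (ultra_fmap _ _ _ _ FU)) [|l [_ ul]]; last by exists l.
by apply: (@filterE _ F) => t; rewrite /= in_itv /= -ler_norml.
Qed.

Section Limits.
Context {R : realType} {d : nat}.
Implicit Types (x y : 'rV[R]_d) (u v : nat -> 'rV[R]_d).

Lemma coord_le_enorm x j : `|x 0 j| <= enorm x.
Proof.
rewrite -(@ler_pXn2r _ 2) // ?nnegrE ?enorm_ge0 //.
rewrite real_normK ?num_real // enorm_sqr dotvE (bigD1 j) //= expr2 lerDl.
by rewrite sumr_ge0 // => i _; rewrite -expr2 sqr_ge0.
Qed.

Definition coord_cvg (F : set_system nat) u x :=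
  forall j, u n 0 j @[n --> F] --> x 0 j.

Lemma ultra_unit_coord_cvg (F : set_system nat) u :
  UltraFilter F -> (forall n, enorm (u n) = 1) -> exists x, coord_cvg F u x.
Proof.
move=> FU u1.
have /choice[l ul] (j : 'I_d) : exists l : R, u n 0 j @[n --> F] --> l.
  apply: (@ultra_bounded_cvg _ _ _ _ 1) => // n.
  by rewrite -(u1 n) coord_le_enorm.
by exists (\row_j l j) => j; rewrite mxE.
Qed.

Lemma coord_cvg_cst (F : set_system nat) {FF : Filter F} x :
  coord_cvg F (fun=> x) x.
Proof. by move=> j; exact: cvg_cst. Qed.

Lemma cvg_dotv (F : set_system nat) {FF : Filter F} u v x y :
  coord_cvg F u x -> coord_cvg F v y ->
  dotv (u n) (v n) @[n --> F] --> dotv x y.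
Proof.
move=> ux vy; rewrite dotvE.
under eq_fun do rewrite dotvE.
by apply: cvg_big => [|j _]; [exact: add_continuous|exact: cvgM].
Qed.

Lemma coord_cvg_orth (F : set_system nat) {FF : ProperFilter F} u x z c :
  \oo `<=` F -> coord_cvg F u x ->
  (forall n, `|dotv (u n) z| <= n.+2%:R^-1 * c) -> dotv x z = 0.
Proof.
move=> ooF ux uz; have h : dotv (u n) z @[n --> F] --> dotv x z.
  by apply: cvg_dotv => //; exact: coord_cvg_cst.
have c0 : n.+2%:R^-1 * c @[n --> F] --> (0 : R).
  rewrite -(mul0r c); apply: cvgMl; apply: (@cvg_trans _ (n.+2%:R^-1 @[n --> \oo])).
    by apply: cvg_app.
  by have := @cvg_harmonic R; rewrite -(cvg_shiftS (@harmonic R)).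
have Nc0 : - (n.+2%:R^-1 * c) @[n --> F] --> (0 : R).
  by rewrite -oppr0; exact: cvgN.
apply: (cvg_unique (@Rhausdorff R) h).
apply: (squeeze_cvgr _ Nc0 c0).
by apply: filterE => n; rewrite -ler_norml.
Qed.

Lemma coord_cvg_neq0 (F : set_system nat) {FF : ProperFilter F} u x :
  coord_cvg F u x -> (forall n, enorm (u n) = 1) -> x != 0.
Proof.
move=> ux u1; rewrite -dotv_eq0; suff -> : dotv x x = 1 by exact: oner_neq0.
have h : dotv (u n) (u n) @[n --> F] --> dotv x x by exact: cvg_dotv.
apply: (cvg_unique (@Rhausdorff R) h).
rewrite (_ : (fun n => dotv (u n) (u n)) = fun=> 1); first exact: cvg_cst.
by apply/funext => n; rewrite -enorm_sqr u1 expr1n.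
Qed.

(** Relaxes [C] meeting [U] and [D] meeting its orthogonal complement: membership becomes
    near-orthogonality to the complementary space, a bound on dot products that survives
    coordinatewise limits. *)
Definition meets_near_all (k : nat) (delta : R) (C D : set 'rV[R]_d) : Prop :=
  forall U : 'M[R]_d, \rank U = k ->
    (exists x, [/\ C x, enorm x = 1 & forall z : 'rV_d, z *m U^T = 0 ->
       `|dotv x z| <= delta * enorm z]) /\
    (exists y, [/\ D y, enorm y = 1 & forall z : 'rV_d, (z <= U)%MS ->
       `|dotv y z| <= delta * enorm z]).

Lemma no_nonpositive_pair_near (k : nat) : (0 < k)%N -> (k < d)%N ->
  exists2 delta : R, 0 < delta < 1 &
    forall C D : set 'rV[R]_d, (forall x y, C x -> D y -> dotv x y <= 0) ->
      ~ meets_near_all k delta C D.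
Proof.
move=> k0 kd; apply: contrapT => /forall2NP noDelta.
have /choice[CD hCD] (n : nat) : exists CD : set 'rV[R]_d * set 'rV[R]_d,
    (forall x y, CD.1 x -> CD.2 y -> dotv x y <= 0) /\
    meets_near_all k n.+2%:R^-1 CD.1 CD.2.
  (* Starting the scales at 1/2 keeps them strictly between 0 and 1. *)
  have [[]|] := noDelta n.+2%:R^-1.
    by rewrite invr_gt0 ltr0n /= invf_lt1 ?ltr0n // ltr1n.
  move/existsNP => [C /existsNP[D /not_implyP[CD /contrapT meet]]].
  by exists (C, D).
have [F [FU ooF]] := ultraFilterLemma (_ : ProperFilter \oo).
have FP : ProperFilter F by exact: ultra_proper.
(* Limits along [F] of selections from the sets [S n]. The single ultrafilter serves every [U] at
   once, where a subsequence would depend on [U]. *)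
pose lims (S : nat -> set 'rV[R]_d) :=
  [set x | exists2 u, (forall n, S n (u n)) & coord_cvg F u x].
apply: (@no_nonpositive_pair _ _ k (lims (fun n => (CD n).1))
  (lims (fun n => (CD n).2))) => //.
- move=> x y [u Cu ux] [v Dv vy].
  apply: (cvgr_to_le (cvg_dotv F _ _ _ _ ux vy)).
  by apply: filterE => n; apply: (hCD n).1.
- move=> U rU.
  have /choice[u hu] (n : nat) := ((hCD n).2 U rU).1.
  have u1 n : enorm (u n) = 1 by have [] := hu n.
  have [x ux] := ultra_unit_coord_cvg F u FU u1.
  exists x; split; last 2 first.
  - exact: (coord_cvg_neq0 F u).
  - apply: orth_orth_sub => z zU; apply: (coord_cvg_orth F u _ _ (enorm z)) => // n.
    by have [_ _] := hu n; exact.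
  by exists u => // n; have [] := hu n.
- move=> U rU.
  have /choice[u hu] (n : nat) := ((hCD n).2 U rU).2.
  have u1 n : enorm (u n) = 1 by have [] := hu n.
  have [x ux] := ultra_unit_coord_cvg F u FU u1.
  exists x; split; last 2 first.
  - exact: (coord_cvg_neq0 F u).
  - apply/orthP => z zU; apply: (coord_cvg_orth F u _ _ (enorm z)) => // n.
    by have [_ _] := hu n; exact.
  by exists u => // n; have [] := hu n.
Qed.

End Limits.

(** * Hausdorff distance and faces *)

Section Faces.
Context {R : realType} {d : nat}.
Implicit Types (x y z c : 'rV[R]_d) (U V : 'M[R]_d) (A B C : set 'rV[R]_d).

Lemma enorm_unitize x : x != 0 -> enorm ((enorm x)^-1 *: x) = 1.
Proof.
move=> x0; rewrite /enorm !dotv_bilinear -/(enorm x) -enorm_sqr expr2.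
by rewrite mulKf ?mulVf ?sqrtr1 // gt_eqF // enorm_gt0.
Qed.

Lemma dist_to_bounds x B : B 0 -> 0 <= dist_to x B <= enorm x.
Proof.
move=> B0; rewrite /dist_to.
have Bx : [set enorm (x - b) | b in B] (enorm x) by exists 0; rewrite ?subr0.
apply/andP; split; last by apply: ge_inf => //; exists 0 => _ [b _ <-]; exact: enorm_ge0.
by apply: lb_le_inf; [exists (enorm x)|move=> _ [b _ <-]; exact: enorm_ge0].
Qed.

(** Ensures that [sup] is a true supremum and not a default value: since [B] contains 0, each
    distance is at most the norm of the point, hence at most 1. *)
Lemma sup_dist_to_bounds A B : A `<=` @unit_ball R d -> A 0 -> B 0 ->
  [/\ 0 <= sup [set dist_to a B | a in A],
      sup [set dist_to a B | a in A] <= 1 &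
      forall a, A a -> dist_to a B <= sup [set dist_to a B | a in A]].
Proof.
move=> A1 A0 B0.
have ub1 : ubound [set dist_to a B | a in A] 1.
  move=> _ [a Aa <-]; have /andP[_ h] := dist_to_bounds a B B0.
  exact: le_trans h (A1 _ Aa).
have le_sup a : A a -> dist_to a B <= sup [set dist_to a B | a in A].
  by move=> Aa; apply: ub_le_sup; [exists 1|exists a].
split => //; last by apply: ge_sup => //; exists (dist_to 0 B); exists 0.
by apply: le_trans (le_sup _ A0); case/andP: (dist_to_bounds 0 B B0).
Qed.

Lemma asin_lt_inv (s t : R) : -1 <= s <= 1 -> -1 <= t <= 1 ->
  asin s < asin t -> s < t.
Proof.
move=> s1 t1; have [sb sE] := asin_def s1; have [tb tE] := asin_def t1.
by move=> st; rewrite -sE -tE ltr_sin // in_itv.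
Qed.

Lemma asin_gt0 (t : R) : 0 < t <= 1 -> 0 < asin t.
Proof.
move=> /andP[t0 t1]; have tN1 : -1 <= t <= 1.
  by rewrite t1 (le_trans _ (ltW t0)) // lerN10.
have [/andP[tb _] tE] := asin_def tN1.
rewrite ltNge; apply/negP => at0.
suff : sin (asin t) <= sin 0 by rewrite tE sin0 leNgt t0.
rewrite leNgt ltr_sin ?in_itv /= -?leNgt // ?tb ?oppr_le0 ?divr_ge0 ?pi_ge0 //.
by rewrite (le_trans at0) ?divr_ge0 ?pi_ge0.
Qed.

Lemma grdistC U V : grdist U V = grdist V U.
Proof. exact: maxC. Qed.

Lemma subsp_ball0 U : (subsp U `&` @unit_ball R d) 0.
Proof. by split; [exact: sub0mx|rewrite /unit_ball /= enorm0 ler01]. Qed.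

Lemma grdist_bounds U V : 0 <= grdist U V <= 1.
Proof.
have [h0 h1 _] := sup_dist_to_bounds _ _ (@subIsetr _ (subsp U) (@unit_ball R d))
  (subsp_ball0 U) (subsp_ball0 V).
have [_ h1' _] := sup_dist_to_bounds _ _ (@subIsetr _ (subsp V) (@unit_ball R d))
  (subsp_ball0 V) (subsp_ball0 U).
by rewrite /grdist /hausdorff le_max h0 ge_max h1.
Qed.

Lemma grdist_lt_near U V (delta : R) x : grdist U V < delta ->
  (x <= U)%MS -> enorm x <= 1 ->
  exists2 y : 'rV[R]_d, (y <= V)%MS & enorm (x - y) < delta.
Proof.
rewrite /grdist /hausdorff gt_max => /andP[Ud _] xU x1.
have [_ _ h] := sup_dist_to_bounds _ _ (@subIsetr _ (subsp U) (@unit_ball R d))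
  (subsp_ball0 U) (subsp_ball0 V).
have := le_lt_trans (h x (conj xU x1)) Ud.
move/inf_lt => [|_ [y [yV _] <-] xy]; last by exists y.
by exists (enorm (x - 0)); exists 0 => //; exact: subsp_ball0.
Qed.

(** Some [y] in [U] is within [delta] of [x], and [z] is orthogonal to [y], so
    [dotv x z = dotv (x - y) z]; Cauchy-Schwarz concludes. *)
Lemma near_orth_dotv U V (delta : R) x z : grdist U V < delta ->
  (x <= V)%MS -> enorm x = 1 -> z *m U^T = 0 ->
  `|dotv x z| <= delta * enorm z.
Proof.
rewrite grdistC => UV xV x1 /orthP zU.
have [|y yU xy] := grdist_lt_near _ _ _ x UV xV; first by rewrite x1.
rewrite -[dotv x z]subr0 -(zU y yU) (dotvC z) -dotvNl -dotvDl.
apply: le_trans (cauchy_schwarz _ _) _.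
by rewrite ler_wpM2r ?enorm_ge0 // ltW.
Qed.

(** Dual estimate: the unit vector along [z] is within [delta] of some [v] in [V], and [y] is
    orthogonal to [v]. *)
Lemma orth_near_dotv U V (delta : R) y z : grdist U V < delta ->
  y *m V^T = 0 -> enorm y = 1 -> (z <= U)%MS ->
  `|dotv y z| <= delta * enorm z.
Proof.
move=> UV /orthP yV y1 zU; have [->|z0] := eqVneq z 0.
  by rewrite dotvC dotv0l normr0 enorm0 mulr0.
have zE : z = enorm z *: ((enorm z)^-1 *: z).
  by rewrite scalerA mulfV ?scale1r // gt_eqF // enorm_gt0.
have [|v vV zv] := grdist_lt_near _ _ _ ((enorm z)^-1 *: z) UV
  (scalemx_sub _ zU); first by rewrite enorm_unitize.
rewrite {1}zE dotvZr normrM ger0_norm ?enorm_ge0 // mulrC.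
rewrite ler_wpM2r ?enorm_ge0 // -[dotv y _]subr0 -(yV v vV) -dotvNr -dotvDr.
by apply: le_trans (cauchy_schwarz _ _) _; rewrite y1 mul1r ltW.
Qed.

Lemma face_unit_vectors k (C : set 'rV[R]_d) U :
    (0 < k)%N -> (k < d)%N -> polyhedral_cone C -> \rank U = k ->
    is_face C (subsp U `&` C) -> set_dim (subsp U `&` C) k ->
  (exists x, [/\ C x, enorm x = 1 & (x <= U)%MS]) /\
  (exists y, [/\ forall x, C x -> dotv x y <= 0, enorm y = 1 & y *m U^T = 0]).
Proof.
move=> k0 kd [m [a CE]] rU [c [Cc faceE]] [M [MS Mfree _]].
have Cscale t x : 0 <= t -> C x -> C (t *: x).
  move=> t0; rewrite CE /= => Cx i.
  by rewrite dotvZr mulr_ge0_le0.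
have MU : (M <= U)%MS by apply/row_subP => i; have [] := MS i.
(* The [k] independent rows of [M] lie in the face and hence span [U], so a normal [c] vanishing on
   the face is orthogonal to all of [U]. *)
have UM : (U <= M)%MS.
  by rewrite -(geq_leqif (mxrank_leqif_sup MU)) rU (eqP Mfree).
split.
  have [i i0] : exists i, row i M != 0.
    apply: contrapT => /forallNP M0; move: k0.
    rewrite -(eqP Mfree) lt0n mxrank_eq0 => /negP; apply; apply/eqP/row_matrixP => i.
    by rewrite row0; apply/eqP; apply: contrapT => /negP; exact: M0.
  have [iU iC] := MS i.
  exists ((enorm (row i M))^-1 *: row i M); split.
  - by apply: Cscale; rewrite ?invr_ge0 ?enorm_ge0.
  - exact: enorm_unitize.
  - exact: scalemx_sub.
(* [c] itself is a witness unless [c = 0], in which case the face is all of [C],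
   so that [C] lies in [U]. *)
have [y [y0 Cy yU]] : exists y, [/\ y != 0, forall x, C x -> dotv x y <= 0 &
    y *m U^T = 0].
  have [c0|c0] := eqVneq c 0.
    have [|y y0 yU] := @exists_orth R d d U; first by rewrite rU.
    exists y; split => // x Cx.
    have [xU _] : (subsp U `&` C) x by rewrite faceE; split; rewrite //= c0 dotv0l.
    by move/orthP: yU => yU; rewrite dotvC yU.
  exists c; split => // [x Cx|]; first by rewrite dotvC Cc.
  apply/orthP => v vU; move: (submx_trans vU UM); move: v {vU}.
  apply/orthP/rowP => i; have : (subsp U `&` C) (row i M) by exact: MS.
  rewrite faceE => -[_ /= ci]; rewrite [RHS]mxE -ci dotvE mxE.
  by apply: eq_bigr => j _; rewrite !mxE.
exists ((enorm y)^-1 *: y); split; last 2 first.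
- exact: enorm_unitize.
- by rewrite -scalemxAl yU scaler0.
move=> x Cx; rewrite dotvZr mulr_ge0_le0 ?invr_ge0 ?enorm_ge0 //; exact: Cy.
Qed.

End Faces.

Theorem theorem2p2 (k d : nat) (hk : (0 < k)%N) (hkd : (k < d)%N) :
  exists eps : Rdefinitions.R, 0 < eps /\
    forall G : set 'M[Rdefinitions.R]_d,
      is_eps_net k eps G ->
      ~ (exists C : set 'rV[Rdefinitions.R]_d,
           polyhedral_cone C /\
           forall U, G U ->
             is_face C (subsp U `&` C) /\ set_dim (subsp U `&` C) k).
Proof.
have [delta /andP[d0 d1] noPair] :=
  @no_nonpositive_pair_near Rdefinitions.R d k hk hkd.
have dN1 : -1 <= delta <= 1 by rewrite (ltW d1) (le_trans _ (ltW d0)) ?lerN10.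
(* Angles below [asin delta] mean distances below [delta]; [delta < 1] keeps it in the domain of
   [asin]. *)
exists (asin delta); split; first by rewrite asin_gt0 // d0 ltW.
move=> G [GGr net] [C [Cpoly faces]].
(* The second set is the polar cone of [C]. Each [U] borrows its two unit vectors from a nearby [V]
   in the net. *)
apply: (noPair C [set y | forall x, C x -> dotv x y <= 0]) => [x y Cx|U rU].
  by apply.
have [V GV UVangle] := net U rU.
have UV : grdist U V < delta.
  have /andP[g0 g1] := grdist_bounds U V.
  by apply: asin_lt_inv UVangle => //; rewrite g1 (le_trans _ g0) ?lerN10.
have [Vface Vdim] := faces V GV.
have [[x [Cx x1 xV]] [y [Cy y1 yV]]] :=
  face_unit_vectors k C V hk hkd Cpoly (GGr V GV) Vface Vdim.
split; [exists x|exists y]; split => // z zU.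
  exact: near_orth_dotv UV xV x1 zU.
exact: orth_near_dotv UV yV y1 zU.
Qed.
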